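(* The star Menger property need not be preserved under preimages of perfect mappings: there exist spaces $X$ and $Y$ and a perfect mapping $f:X\to Y$ such that $Y$ is star Menger but $X=f^{-1}[Y]$ is not star Menger.
   Context: All spaces are assumed to be regular and $T_1$. For a family $\mathcal{U}$ of subsets of $X$ and $A\subseteq X$, $St(A,\mathcal{U})=\bigcup\{U\in\mathcal{U}:U\cap A\neq\emptyset\}$. A space $M$ is Menger if for every sequence $\{\mathcal{U}_n:n\in\omega\}$ of open covers of $M$ there are finite subcollections $\mathcal{V}_n\subseteq\mathcal{U}_n$ ($n\in\omega$) such that $\bigcup\{\mathcal{V}_n:n\in\omega\}$ is an open cover of $M$. A space $X$ is star Menger if for every open cover $\mathcal{U}$ of $X$ there is a subspace $M\subseteq X$ which is Menger and satisfies $St(M,\mathcal{U})=X$. A mapping is perfect if it is continuous, closed and all its fibres $f^{-1}(y)$ are compact. *)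

(* Defs.v *)
From HB Require Import structures.
From mathcomp Require Import all_boot all_order all_algebra.
From mathcomp Require Import all_classical all_reals topology.

Set Implicit Arguments.
Unset Strict Implicit.
Unset Printing Implicit Defensive.

Local Open Scope classical_set_scope.

Definition regular_T1 (T : topologicalType) : Prop :=
  regular_space T /\ accessible_space T.

Definition open_cover (T : topologicalType) (U : set (set T)) : Prop :=
  U `<=` open /\ \bigcup_(A in U) A = setT.

Definition star (T : Type) (A : set T) (U : set (set T)) : set T :=
  \bigcup_(B in [set B | U B /\ B `&` A !=set0]) B.

Definition menger (T : topologicalType) : Prop :=
  forall U : nat -> set (set T), (forall n, open_cover (U n)) ->
  exists V : nat -> set (set T),
    (forall n, finite_set (V n) /\ V n `<=` U n) /\
    open_cover (\bigcup_n V n).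

(* [set_type M] is [M] as a type; its canonical topology (subtype_topology)
   is the subspace topology. The library's [subspace M] is not used here: it
   has the whole of [X] as points. *)
Definition star_menger (X : topologicalType) : Prop :=
  forall U : set (set X), open_cover U ->
  exists M : set X, menger (set_type M) /\ star M U = setT.

(* Surjectivity is not part of the notion. *)
Definition perfect_map (X Y : topologicalType) (f : X -> Y) : Prop :=
  [/\ continuous f,
      forall C : set X, closed C -> closed (f @` C)
    & forall y : Y, compact (f @^-1` [set y])].

(* Main.v *)
From HB Require Import structures.
Require Import Defs.
From mathcomp Require Import all_boot all_order all_algebra.
From mathcomp Require Import all_classical all_reals topology.

(** Let [Y] be a star Menger space with an uncountable closed discrete subset
[D], and let [X] be the disjoint sum of [Y] and a copy of [D].  The map
[X -> Y] which is the identity on [Y] and the inclusion on [D] is perfect.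
The copy of [D] is clopen and discrete in [X], so, for the cover of [X] by its
points and its complement, a set whose star is [X] contains all of [D]; such a
set has an uncountable clopen discrete part and cannot be Menger.  For [Y] we
take the Mrowka space of the branches of the binary tree: it is star Menger
because it is separable, and the branches form an uncountable closed discrete
subset. *)

Set Implicit Arguments.
Unset Strict Implicit.
Unset Printing Implicit Defensive.

Local Open Scope classical_set_scope.

(* Points of [P] are isolated and each [i : I] is the limit of [s i]. With
   [P] enlarged by isolated points lying on no sequence, the same construction
   also gives the sum of a Mrowka space with a discrete space. *)
Definition psi (P I : Type) (s : I -> nat -> P) : Type := (P + I)%type.

Section Psi.
Variables (P I : Type) (s : I -> nat -> P).

HB.instance Definition _ := gen_eqMixin (psi s).
HB.instance Definition _ := gen_choiceMixin (psi s).

Definition psi_open (U : set (psi s)) : Prop :=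
  forall i, U (inr i) -> exists n, forall m, n <= m -> U (inl (s i m)).

Lemma psi_openT : psi_open setT.
Proof. by move=> i _; exists 0. Qed.

Lemma psi_openI : setI_closed psi_open.
Proof.
move=> A B oA oB i [/oA[n An] /oB[k Bk]]; exists (maxn n k) => m.
by rewrite geq_max => /andP[/An ? /Bk].
Qed.

Lemma psi_open_bigcup (J : Type) (F : J -> set (psi s)) :
  (forall j, psi_open (F j)) -> psi_open (\bigcup_j F j).
Proof.
move=> oF i [j _ /oF[n Fn]]; exists n => m /Fn Fm.
by exists j.
Qed.

HB.instance Definition _ :=
  isOpenTopological.Build (psi s) psi_openT psi_openI psi_open_bigcup.

Lemma psi_openE (U : set (psi s)) : open U = psi_open U.
Proof. by []. Qed.

Hypothesis s_fin : forall i p, exists n, forall m, n <= m -> s i m <> p.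
Hypothesis s_ad :
  forall i j, i <> j -> exists n, forall m k, n <= m -> s i m <> s j k.

(** By [s_fin] no sequence returns to an isolated point forever, so its singleton is closed. By
    [s_ad] any other sequence finally leaves the [i]-th one, so a tail together with its limit is
    closed. *)
Lemma psi_clopen_base (U : set (psi s)) (x : psi s) :
  open U -> U x -> exists C : set (psi s), [/\ clopen C, C x & C `<=` U].
Proof.
move=> oU; case: x => [p Up|i Ui].
  exists [set inl p]; split=> //; last by move=> _ ->.
  split; first by rewrite psi_openE.
  rewrite -openC psi_openE => j _; have [n np] := s_fin j p.
  by exists n => m /np sp [].
have [n Un] := oU _ Ui.
exists [set y | y = inr i \/ exists2 m, n <= m & y = inl (s i m)].
split; [split|by left|by move=> y [->//|[m /Un ? ->]]].
  rewrite psi_openE => j [[->]|[m]//]; exists n => m nm; right.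
  by exists m.
rewrite -openC psi_openE => j /= nj.
have [k sk] : exists k, forall m l, k <= m -> s j m <> s i l.
  by apply: s_ad => ji; apply: nj; left; rewrite ji.
by exists k => m km [//|[l _ [/(sk _ _ km)]]].
Qed.

Lemma psi_regular_T1 : regular_T1 (psi s).
Proof.
split.
  move=> x A; rewrite nbhsE => -[U [oU Ux] UA].
  have [C [[oC cC] Cx CU]] := psi_clopen_base oU Ux.
  exists C; first by exists C.
  by rewrite -(closure_id _).1//; exact: subset_trans UA.
move=> x y /eqP xy; exists (~` [set y]); split; last 2 first.
- by rewrite inE.
- by rewrite inE setCK.
rewrite psi_openE => i _; case: y {xy} => [p|j]; last by exists 0.
by have [n sp] := s_fin i p; exists n => m /sp ? [].
Qed.

End Psi.

(** The [n]-th cover only has to take care of the at most one point with code [n]. *)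
Lemma countable_menger (T : topologicalType) :
  countable [set: T] -> menger T.
Proof.
move=> /countable_injP[f f_inj] U Ucov.
have UT n t : exists2 A, U n A & A t.
  by have [_ UE] := Ucov n; have : (\bigcup_(A in U n) A) t by rewrite UE.
have /choice[V VP] (n : nat) : exists V : set (set T),
    [/\ finite_set V, V `<=` U n & forall t, f t = n -> exists2 A, V A & A t].
  have [[t ft]|nf] := pselect (exists t, f t = n); last first.
    by exists set0; split=> // t ft; case: nf; exists t.
  have [A UA At] := UT n t; exists [set A]; split=> [//|_ ->//|u fu].
  exists A => //; suff -> : u = t by [].
  by apply: f_inj; rewrite ?inE// fu ft.
exists V; split=> [n|]; first by have [] := VP n.
split=> [A [n _ VA]|].
  by have [_ VU _] := VP n; have [oU _] := Ucov n; exact/oU/VU.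
rewrite -subTset => t _; have [_ _ /(_ t erefl)[A VA At]] := VP (f t).
by exists A => //; exists (f t).
Qed.

(** The isolated points form a countable dense set: an open set around a limit contains a tail of
    its sequence. *)
Lemma psi_star_menger (P I : Type) (s : I -> nat -> P) :
  countable [set: P] -> star_menger (psi s).
Proof.
move=> /countable_injP[f f_inj] U [oU Ucov]; exists (range inl); split.
  apply: countable_menger; apply/countable_injP.
  (* The value 0 is never taken as a default, since all points here come from [inl]. *)
  exists (fun x => if set_val x is inl p then f p else 0).
  move=> [x xP] [y yP] _ _; rewrite !set_valE /= => fxy.
  apply: eq_exist; move: (set_mem xP) (set_mem yP) fxy => [p _ <-] [q _ <-] /=.
  by move=> /f_inj ->//; rewrite inE.
rewrite -subTset => x _.
have [A UA Ax] : (\bigcup_(A in U) A) x by rewrite Ucov.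
exists A => //; split=> //; case: x Ax => [p Ap|i].
  by exists (inl p); split=> //; exists p.
move=> /(oU _ UA)[n /(_ n (leqnn n)) An].
by exists (inl (s i n)); split=> //; exists (s i n).
Qed.

Lemma cantor_not_injective (h : (nat -> bool) -> nat) : ~ injective h.
Proof.
(* For injective [h], the diagonal [d] differs from each [b] at [h b], hence from itself at
   [h d]. *)
move=> h_inj; pose d n := `[< exists2 b, h b = n & ~~ b n >].
case: (boolP (d (h d))) => [dd|dd]; last first.
  by move: (dd) => /asboolPn; apply; exists d.
by have /asboolP[b /h_inj -> /negP] := dd.
Qed.

Lemma psi_not_star_menger (P I : Type) (s : I -> nat -> P)
    (e : (nat -> bool) -> P) :
  injective e -> (forall i n b, s i n <> e b) -> ~ star_menger (psi s).
Proof.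
move=> e_inj se; pose pt b : psi s := inl (e b).
have pt_inj : injective pt by move=> a b [/e_inj].
pose U : set (set (psi s)) := [set A | A = ~` range pt \/
  exists b, A = [set pt b]].
have U_pt A b : U A -> A (pt b) -> A = [set pt b].
  by case=> [->[]|[c -> <-//]]; exists b.
have Ucov : open_cover U.
  split=> [A [->|[b ->]]|].
  - by rewrite psi_openE => i _; exists 0 => m _ [b _ [/esym/se]].
  - by rewrite psi_openE.
  rewrite -subTset => x _.
  have [[b _ <-]|xD] := pselect (range pt x).
    by exists [set pt b] => //; right; exists b.
  by exists (~` range pt) => //; left.
move=> /(_ U Ucov)[M [Mm starM]].
(* The only member of [U] around [pt b] is its singleton, which meets [M] only if [M] contains
   [pt b]. *)
have M_pt b : M (pt b).
  have [A [UA [x [Ax Mx]]] Ab] : star M U (pt b) by rewrite starM.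
  by move: Ax Mx; rewrite (U_pt _ _ UA Ab) => ->.
pose v b : set_type M := exist _ (pt b) (mem_set (M_pt b)).
pose pre (A : set (psi s)) : set (set_type M) := set_val @^-1` A.
(* A constant sequence of covers suffices: the countably many selected sets must include all the
   distinct traces [pre [set pt b]]. *)
have [|V [VU [_ Vcov]]] := Mm (fun=> pre @` U).
  move=> _; split=> [_ [A UA <-]|].
    by exists A => //; case: Ucov => oU _; exact: oU.
  rewrite -subTset => x _; case: Ucov => _ Ucov.
  have [A UA Ax] : (\bigcup_(A in U) A) (set_val x) by rewrite Ucov.
  by exists (pre A) => //; exists A.
have /countable_injP[g g_inj] : countable (\bigcup_n V n).
  apply: bigcup_countable => // n _.
  by apply: finite_set_countable; have [] := VU n.
have Vpre b : (\bigcup_n V n) (pre [set pt b]).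
  have [B [n _ VB] Bb] : (\bigcup_(B in \bigcup_n V n) B) (v b).
    by rewrite Vcov.
  exists n => //; have [_ /(_ _ VB)[A UA AB]] := VU n.
  by rewrite -(U_pt A b UA) ?AB//; rewrite -AB in Bb.
apply: (@cantor_not_injective (fun b => g (pre [set pt b]))) => a b /g_inj.
rewrite !inE => /(_ (Vpre a) (Vpre b)) prE.
by have : pre [set pt a] (v a) by []; rewrite prE => /pt_inj.
Qed.

Lemma mkseq_finite (b : nat -> bool) (t : seq bool) :
  exists n, forall m, n <= m -> mkseq b m <> t.
Proof.
exists (size t).+1 => m + bt; rewrite -bt size_mkseq.
by rewrite ltnn.
Qed.

Lemma mkseq_almost_disjoint (a b : nat -> bool) : a <> b ->
  exists n, forall m k, n <= m -> mkseq a m <> mkseq b k.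
Proof.
move=> ab; have [n abn] : exists n, a n <> b n.
  apply: contrapT => abN; apply: ab; apply/funext => n.
  by apply: contrapT => abn; apply: abN; exists n.
(* A prefix of length [m] shows the entry at [n] only if [m > n]; equal prefixes have equal lengths,
   so the bound serves every [k]. *)
exists n.+1 => m k nm abE.
have mk : m = k by rewrite -(size_mkseq a m) abE size_mkseq.
move: abE; rewrite -mk => /(congr1 (nth false ^~ n)).
by rewrite !nth_mkseq.
Qed.

Definition tree_space := psi (@mkseq bool).

(** The isolated points [inr b] of the enlarged set lie on no sequence; they are the discrete copy
    of the branches. *)
Definition tree_sum_prefix (b : nat -> bool) (n : nat) :
  seq bool + (nat -> bool) := inl (mkseq b n).

Definition tree_sum := psi tree_sum_prefix.

Definition fold_tree (x : tree_sum) : tree_space :=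
  match x with
  | inl (inl t) => inl t
  | inl (inr b) => inr b
  | inr b => inr b
  end.

Lemma fold_tree_perfect : perfect_map fold_tree.
Proof.
split.
- apply/continuousP => A; rewrite !psi_openE => oA b /oA[n An]; by exists n.
(* A node has a single preimage, so a tail of nodes missing [C] upstairs misses the image of [C]
   downstairs. *)
- move=> C; rewrite -openC psi_openE => oC.
  rewrite -openC psi_openE => b fCb.
  have [|n Cn] := oC b; first by move=> Cb; apply: fCb; exists (inr b).
  exists n => m /Cn Cm [[[t|?]|?]]//= Ct [tE].
  by apply: Cm; rewrite /tree_sum_prefix -tE.
- move=> y; apply: finite_compact; case: y => [t|b].
    apply: (@sub_finite_set _ _ [set inl (inl t)]) => //.
    by move=> [[u|?]|?]//= [->].
  apply: (@sub_finite_set _ _ [set inl (inr b); inr b]) => //.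
  by move=> [[?|c]|c]//= [->]; [left|right].
Qed.

Theorem proposition4p15 :
  exists (X Y : topologicalType) (f : X -> Y),
    [/\ regular_T1 X, regular_T1 Y, perfect_map f,
        star_menger Y & ~ star_menger X].
Proof.
exists tree_sum, tree_space, fold_tree; split.
- apply: psi_regular_T1 => [b [t|c]|a b /mkseq_almost_disjoint[n abn]].
  + by have [n bt] := mkseq_finite b t; exists n => m /bt ? [].
  + by exists 0.
  + by exists n => m k /abn abm [/abm].
- apply: psi_regular_T1; first exact: mkseq_finite.
  exact: mkseq_almost_disjoint.
- exact: fold_tree_perfect.
- exact/psi_star_menger/countableP.
- by apply: (@psi_not_star_menger _ _ _ inr) => // a b [].
Qed.
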